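(* The (exponential) generating function of the bivariate Lah-Bell polynomials is given by $$\left(1+y\left(\frac{1}{1-t}-1\right)\right)^{x}=\sum_{n=0}^{\infty}B_{n}^{L}(x,y)\frac{t^{n}}{n!},$$ as an identity of formal power series in $t$ with coefficients polynomials in $x$ and $y$.
   Context: The falling factorial is $(x)_0=1$ and $(x)_n=x(x-1)\cdots(x-n+1)$ for $n\ge 1$. For integers $n,k\ge 0$, the unsigned Lah number $L(n,k)$ is the number of ways a set of $n$ elements can be partitioned into $k$ nonempty linearly ordered subsets (so $L(0,0)=1$, $L(n,0)=0$ for $n\ge 1$, $L(n,k)=0$ for $k>n$, and $L(n,k)=\binom{n-1}{k-1}\frac{n!}{k!}$ for $n\ge k\ge 1$). The bivariate Lah-Bell polynomials are $B_n^L(x,y)=\sum_{k=0}^n L(n,k)(x)_k y^k$ for $n\ge 0$. For a power series $u$ in $t$ with zero constant term, $(1+u)^x=\sum_{k\ge 0}\binom{x}{k}u^k$ with $\binom{x}{k}=\frac{(x)_k}{k!}$. *)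

(* Defs.v *)
From HB Require Import structures.
From mathcomp Require Import all_boot all_order all_algebra.
From mathcomp Require Import boolp.
From mathcomp Require Import mpoly.

Set Implicit Arguments.
Unset Strict Implicit.
Unset Printing Implicit Defensive.

Import GRing.Theory.
Local Open Scope ring_scope.

(** * Formal power series in one variable *)

Record fps (A : Type) := FPS { fps_coef : nat -> A }.

Lemma fpsP (A : Type) (f g : fps A) :
  (forall n, fps_coef f n = fps_coef g n) <-> f = g.
Proof.
split=> [|-> //]; case: f g => [f] [g] /= fg.
by congr FPS; apply/funext.
Qed.

HB.instance Definition _ (A : Type) := gen_eqMixin (fps A).
HB.instance Definition _ (A : Type) := gen_choiceMixin (fps A).

Section FpsRing.
Variable A : comNzRingType.
Implicit Types f g h : fps A.

Definition fpsC (a : A) : fps A := FPS (fun n => if n is 0%N then a else 0).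
Definition fpsX : fps A := FPS (fun n => (n == 1%N)%:R).

Definition fps_add f g := FPS (fun n => fps_coef f n + fps_coef g n).
Definition fps_opp f := FPS (fun n => - fps_coef f n).
Definition fps_mul f g :=
  FPS (fun n => \sum_(i < n.+1) fps_coef f i * fps_coef g (n - i)%N).

Fact fps_addA : associative fps_add.
Proof. by move=> f g h; apply/fpsP => n /=; rewrite addrA. Qed.
Fact fps_addC : commutative fps_add.
Proof. by move=> f g; apply/fpsP => n /=; rewrite addrC. Qed.
Fact fps_add0 : left_id (fpsC 0) fps_add.
Proof. by move=> f; apply/fpsP => -[|n] /=; rewrite add0r. Qed.
Fact fps_addN : left_inverse (fpsC 0) fps_opp fps_add.
Proof. by move=> f; apply/fpsP => -[|n] /=; rewrite addNr. Qed.

HB.instance Definition _ :=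
  GRing.isZmodule.Build (fps A) fps_addA fps_addC fps_add0 fps_addN.

Let trunc n f : {poly A} := \poly_(i < n) fps_coef f i.

Let coef_mul_trunc n i f g : (i < n)%N ->
  fps_coef (fps_mul f g) i = (trunc n f * trunc n g)`_i.
Proof.
move=> lt_in; rewrite coefM /=; apply: eq_bigr => -[j /= le_ji] _.
by rewrite !coef_poly (leq_ltn_trans _ lt_in) // (leq_ltn_trans (leq_subr _ _)).
Qed.

Fact fps_mulC : commutative fps_mul.
Proof.
by move=> f g; apply/fpsP => n; rewrite !(@coef_mul_trunc n.+1) // mulrC.
Qed.
Fact fps_mulA : associative fps_mul.
Proof.
have coef3 f g h n : fps_coef (fps_mul (fps_mul f g) h) n
    = (trunc n.+1 f * trunc n.+1 g * trunc n.+1 h)`_n.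
  rewrite coefM [LHS]/=; apply: eq_bigr => -[j /= le_jn] _.
  rewrite -(@coef_mul_trunc n.+1) //.
  by rewrite coef_poly ltnS leq_subr.
move=> f g h; apply/fpsP => n.
by rewrite fps_mulC !coef3 mulrC mulrA.
Qed.
Fact fps_mul1 : left_id (fpsC 1) fps_mul.
Proof.
move=> f; apply/fpsP => n /=.
rewrite big_ord_recl /= subn0 mul1r big1 ?addr0 // => i _.
by rewrite mul0r.
Qed.
Fact fps_mulDl : left_distributive fps_mul fps_add.
Proof.
move=> f g h; apply/fpsP => n /=.
by rewrite -big_split /=; apply: eq_bigr => i _; rewrite mulrDl.
Qed.
Fact fps_one_neq0 : fpsC 1 != 0 :> fps A.
Proof.
by apply/eqP => /fpsP /(_ 0%N) /= /eqP; rewrite (oner_eq0 A).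
Qed.

HB.instance Definition _ := GRing.Zmodule_isComNzRing.Build (fps A)
  fps_mulA fps_mulC fps_mul1 fps_mulDl fps_one_neq0.

Lemma coef_fpsD f g n : fps_coef (f + g) n = fps_coef f n + fps_coef g n.
Proof. by []. Qed.
Lemma coef_fpsN f n : fps_coef (- f) n = - fps_coef f n.
Proof. by []. Qed.
Lemma coef_fpsM f g n :
  fps_coef (f * g) n = \sum_(i < n.+1) fps_coef f i * fps_coef g (n - i)%N.
Proof. by []. Qed.
Lemma coef_fps1 n : fps_coef (1 : fps A) n = (n == 0%N)%:R.
Proof. by case: n. Qed.
Lemma coef_fpsCM a f n : fps_coef (fpsC a * f) n = a * fps_coef f n.
Proof.
rewrite coef_fpsM big_ord_recl /= subn0 big1 ?addr0 // => i _.
by rewrite mul0r.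
Qed.
Lemma coef_fps_sum I (r : seq I) (P : pred I) (F : I -> fps A) n :
  fps_coef (\sum_(i <- r | P i) F i) n = \sum_(i <- r | P i) fps_coef (F i) n.
Proof.
apply: (big_morph (fun f => fps_coef f n)) => [f g|]; first exact: coef_fpsD.
by case: n.
Qed.

Lemma coef_fps_expn_lt f k n :
  fps_coef f 0 = 0 -> (n < k)%N -> fps_coef (f ^+ k) n = 0.
Proof.
move=> f0; elim: k n => // k IHk n lt_nk; rewrite exprS coef_fpsM big1 // => i _.
have [-> | i_gt0] := posnP i; first by rewrite f0 mul0r.
rewrite IHk ?mulr0 //; apply: leq_trans (_ : n <= k)%N => //.
by rewrite ltn_subrL i_gt0 (leq_trans i_gt0) // -ltnS ltn_ord.
Qed.

(** The series [\sum_(k >= 0) a k * u ^+ k], meaningful when [u] has zero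
    constant term: [u ^+ k] then has no term of degree less than [k], so each
    coefficient is a finite sum (see [fps_subst_partial]). *)
Definition fps_subst (a : nat -> A) (u : fps A) : fps A :=
  FPS (fun n => \sum_(k < n.+1) a k * fps_coef (u ^+ k) n).

Lemma fps_subst_partial (a : nat -> A) (u : fps A) n N :
    fps_coef u 0 = 0 -> (n < N)%N ->
  fps_coef (fps_subst a u) n = fps_coef (\sum_(k < N) fpsC (a k) * u ^+ k) n.
Proof.
move=> u0 lt_nN; rewrite coef_fps_sum [LHS]/=.
under [RHS]eq_bigr => k _ do rewrite coef_fpsCM.
rewrite (big_ord_widen N (fun k => a k * fps_coef (u ^+ k) n)) //.
rewrite big_mkcond; apply: eq_bigr => k _; case: ifPn => //.
by rewrite -leqNgt => lt_nk; rewrite coef_fps_expn_lt ?mulr0.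
Qed.

End FpsRing.

(** A series is invertible exactly when its constant term [c] is; its inverse is
    then [c^-1 * \sum_(k >= 0) (1 - c^-1 * f) ^+ k]. *)
Section FpsUnitRing.
Variable A : comUnitRingType.
Implicit Types f g : fps A.

Definition fps_unit : {pred fps A} := [pred f | fps_coef f 0 \is a GRing.unit].

Definition fps_inv f : fps A :=
  if f \in fps_unit then
    let c := fpsC (fps_coef f 0)^-1 in c * fps_subst (fun=> 1) (1 - c * f)
  else f.

Fact fps_mulV : {in fps_unit, left_inverse 1 fps_inv *%R}.
Proof.
move=> f Uf; rewrite /fps_inv Uf; set c := fpsC _.
set h := 1 - c * f; have h0 : fps_coef h 0 = 0.
  by rewrite coef_fpsD coef_fpsN coef_fpsCM coef_fps1 mulVr ?subrr.
have -> : c * fps_subst (fun=> 1) h * f = fps_subst (fun=> 1) h * (1 - h).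
  by rewrite /h opprB addrCA subrr addr0 mulrAC mulrC.
apply/fpsP => n.
have -> : fps_coef (fps_subst (fun=> 1) h * (1 - h)) n
    = fps_coef ((\sum_(k < n.+1) h ^+ k) * (1 - h)) n.
  rewrite !coef_fpsM; apply: eq_bigr => i _; congr (_ * _).
  rewrite (@fps_subst_partial _ _ _ _ n.+1) //.
  by congr fps_coef; apply: eq_bigr => k _; rewrite [fpsC 1 * _]mul1r.
rewrite mulrC -(opprB h 1) mulNr -subrX1 opprB.
by rewrite coef_fpsD coef_fpsN coef_fps_expn_lt // subr0.
Qed.

Fact fps_unitP f g : g * f = 1 -> fps_unit f.
Proof.
move=> /fpsP /(_ 0%N); rewrite coef_fpsM big_ord1 coef_fps1 => gf1.
by apply/unitrPr; exists (fps_coef g 0); rewrite mulrC.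
Qed.

Fact fps_inv_out : {in [predC fps_unit], fps_inv =1 id}.
Proof. by move=> f /negbTE Uf; rewrite /fps_inv Uf. Qed.

HB.instance Definition _ := GRing.ComNzRing_hasMulInverse.Build (fps A)
  fps_mulV fps_unitP fps_inv_out.

End FpsUnitRing.

(** * Falling factorials and binomial powers *)

Definition ffactr (A : comNzRingType) (x : A) (n : nat) : A :=
  \prod_(i < n) (x - i%:R).

(** Meaningful when all [k`!%:R] are units of [A], e.g. for polynomials over a
    field of characteristic 0. *)
Definition binr (A : comUnitRingType) (x : A) (k : nat) : A :=
  ffactr x k / k`!%:R.

(** [fps_powr f x] is [f ^ x], for [f = 1 + u] with [u] of zero constant term. *)
Definition fps_powr (A : comUnitRingType) (f : fps A) (x : A) : fps A :=
  fps_subst (binr x) (f - 1).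

(** * Lah numbers and bivariate Lah-Bell polynomials *)

(** A nonempty linearly ordered subset of ['I_n] is encoded as the
    duplicate-free nonempty sequence listing it in increasing order; such a
    sequence has size at most [n], whence the finite type [n.-bseq 'I_n]. *)
Definition lah_partition (n : nat) (P : {set n.-bseq 'I_n}) : bool :=
  [forall s in P, (s != [::] :> seq 'I_n) && uniq s] &&
  [forall i : 'I_n, #|[set s in P | i \in (s : seq 'I_n)]| == 1%N].

Definition lah (n k : nat) : nat :=
  #|[set P : {set n.-bseq 'I_n} | lah_partition P && (#|P| == k)]|.

Definition lah_bell (A : comNzRingType) (n : nat) (x y : A) : A :=
  \sum_(k < n.+1) (lah n k)%:R * ffactr x k * y ^+ k.

(* Main.v *)
Require Import Defs.
From mathcomp Require Import all_boot all_order all_algebra.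
From mathcomp Require Import mpoly.

Set Implicit Arguments.
Unset Strict Implicit.

Import GRing.Theory.
Local Open Scope ring_scope.

(** Expanding the left side by the binomial series, the coefficient of [t ^ n] is
    the sum over [k] of [(x)_k / k! * y ^ k * c n k], where [c n k] is the
    coefficient of [t ^ n] in [u ^+ k] and [u = 1 / (1 - t) - 1 = t + t^2 + ...].
    So everything reduces to the identity [k! * L(n, k) = n! * c n k].

    That identity is a double count of the arrangements: the [k]-tuples of
    nonempty words on ['I_n] whose concatenation lists every element of ['I_n]
    exactly once.
    - Forgetting the order of the words maps an arrangement to a partition into
      [k] ordered blocks, and exactly [k!] arrangements lie above each partition
      ([card_arrangement_lah]).
    - Concatenating the words maps an arrangement to one of the [n!] permutations
      of ['I_n], and above each permutation lie as many arrangements as there are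
      ways of cutting a word of length [n] into [k] nonempty pieces
      ([card_arrangement_coef]). Since [u] is the sum of the positive powers of
      [t], each with coefficient [1], that number is [c n k]
      ([card_splittings]). *)

(** * Arrangements and Lah partitions *)

Definition concat {T : Type} {n : nat} (ss : seq (n.-bseq T)) : seq T :=
  flatten [seq bseqval s | s <- ss].

Definition nonemptyb {T : eqType} {n : nat} (s : n.-bseq T) : bool :=
  s != [::] :> seq T.

(** The last two conditions say that the concatenation is a permutation of
    ['I_n]. *)
Definition arrangement {n k : nat} (t : k.-tuple (n.-bseq 'I_n)) : bool :=
  [&& all nonemptyb t, uniq (concat t) & size (concat t) == n].

Lemma count_concat {T : eqType} {n : nat} (a : pred T) (ss : seq (n.-bseq T)) :
  count a (concat ss) = (\sum_(s <- ss) count a s)%N.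
Proof. by rewrite count_flatten sumnE !big_map. Qed.

Lemma uniq_concat_block {T : eqType} {n : nat} (s : n.-bseq T) ss :
  s \in ss -> uniq (concat ss) -> uniq s.
Proof.
elim: ss => //= s' ss IHss; rewrite inE /concat /= cat_uniq.
by case/predU1P=> [-> | /IHss uniq_s] /and3P[// _ _ /uniq_s].
Qed.

(** A word occurring twice would repeat its letters in the concatenation, and it
    has letters since it is nonempty. *)
Lemma arrangement_uniq n k (t : k.-tuple (n.-bseq 'I_n)) :
  arrangement t -> uniq t.
Proof.
case/and3P=> + + _; elim: (val t) => //= s ss IHss /andP[s_neq0 ss_neq0].
rewrite /concat /= cat_uniq => /and3P[_ disj uniq_ss].
rewrite IHss // andbT; apply: contra disj => s_ss.
case def_s: (bseqval s) s_neq0 => [|i s']; first by rewrite /nonemptyb def_s.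
move=> _; apply/hasP; exists i; last by rewrite /= mem_head.
apply/flattenP; exists (bseqval s); first exact: map_f.
by rewrite def_s mem_head.
Qed.

Lemma count_mem_arrangement n k (t : k.-tuple (n.-bseq 'I_n)) :
  arrangement t -> forall i, count_mem i (concat t) = 1%N.
Proof.
case/and3P=> _ uniq_t /eqP size_t i; rewrite count_uniq_mem //.
have le_t : (size (enum 'I_n) <= size (concat t))%N.
  by rewrite size_t size_enum_ord.
have sub_t : {subset concat t <= enum 'I_n} by move=> j _; rewrite mem_enum.
have [_ ->] := uniq_min_size uniq_t sub_t le_t.
by rewrite mem_enum.
Qed.

(** Describes the fiber of the map from arrangements to partitions: the tuples
    above [P] are the enumerations of [P]. Each letter occurs once in such an
    enumeration because exactly one block of [P] contains it, and that block is
    duplicate-free. *)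
Lemma arrangementE n k (P : {set n.-bseq 'I_n}) (t : k.-tuple (n.-bseq 'I_n)) :
    lah_partition P -> #|P| = k ->
  arrangement t && ([set s in t] == P) = all (mem P) t && uniq t.
Proof.
case/andP=> /forall_inP P_block /forallP P_cover card_P.
apply/andP/andP=> [[arr_t /eqP <-] | [/allP t_P uniq_t]].
  split; last exact: arrangement_uniq arr_t.
  by apply/allP=> s; rewrite /= inE.
have tP: [set s in t] = P.
  apply/eqP; rewrite eqEcard card_P cardsE (card_uniqP uniq_t) size_tuple leqnn.
  by rewrite andbT; apply/subsetP=> s; rewrite inE => /t_P.
rewrite tP eqxx; split=> //.
have count1 i : count_mem i (concat t) = 1%N.
  rewrite count_concat -(eqP (P_cover i)) -sum1_card big_uniq //=.
  rewrite [RHS]big_mkcond [LHS]big_mkcond /=; apply: eq_bigr => s _.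
  have -> : (s \in tval t) = (s \in P) by rewrite -tP inE.
  rewrite inE; case: ifP => //= /P_block/andP[_ uniq_s].
  by rewrite count_uniq_mem //; case: (_ \in _).
have perm_t : perm_eq (concat t) (enum 'I_n).
  by apply/allP=> i _ /=; rewrite count1 count_uniq_mem ?enum_uniq // mem_enum.
rewrite /arrangement (perm_uniq perm_t) (perm_size perm_t) enum_uniq.
rewrite size_enum_ord eqxx !andbT; apply/allP=> s /t_P /= /P_block.
by case/andP.
Qed.

Lemma arrangement_lah n k (t : k.-tuple (n.-bseq 'I_n)) :
  arrangement t -> lah_partition [set s in t] && (#|[set s in t]| == k).
Proof.
move=> arr_t; have uniq_t := arrangement_uniq arr_t.
have count1 := count_mem_arrangement arr_t.
rewrite cardsE (card_uniqP uniq_t) size_tuple eqxx andbT.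
have /and3P[/allP t_neq0 uniq_ct _] := arr_t.
have uniq_s s : s \in t -> uniq s.
  by move=> s_t; apply: uniq_concat_block uniq_ct.
apply/andP; split.
  apply/forall_inP=> s; rewrite inE => s_t.
  by rewrite uniq_s // andbT; apply: t_neq0.
apply/forallP=> i; rewrite -(count1 i) count_concat -sum1_card big_uniq //=.
apply/eqP; rewrite [LHS]big_mkcond [RHS]big_mkcond; apply: eq_bigr => s _.
rewrite !inE; case: (boolP (s \in t)) => //= s_t.
by rewrite count_uniq_mem ?uniq_s //; case: (_ \in _).
Qed.

Lemma card_arrangement_lah n k :
  #|[set t : k.-tuple (n.-bseq 'I_n) | arrangement t]| = (k`! * lah n k)%N.
Proof.
rewrite -sum1dep_card.
rewrite (partition_big (fun t : k.-tuple _ => [set s in t])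
          (fun P => lah_partition P && (#|P| == k))) /=; last first.
  exact: arrangement_lah.
rewrite mulnC /lah -sum1dep_card big_distrl /=.
apply: eq_bigr => P /andP[lahP /eqP card_P].
rewrite mul1n (eq_bigl (fun t : k.-tuple _ => all (mem P) t && uniq t)).
  by rewrite sum1dep_card card_uniq_tuples card_P ffactnn.
by move=> t; apply: arrangementE.
Qed.

(** * Cutting a word into nonempty pieces *)

Section Splittings.

Variables (A : comNzRingType) (u : fps A).
Hypothesis uE : forall m, fps_coef u m = (0 < m)%:R.

(** By induction on [k], removing the first piece: a first piece of length [i]
    must be the prefix [take i w], and is allowed when [0 < i], which is the
    [i]-th coefficient of [u]. Summing over [i] gives the Cauchy product
    [u * u ^+ k]. The bound [size w <= n] ensures that every factor of [w] fits
    in the type [n.-bseq T]. *)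
Lemma card_splittings (T : finType) (n k : nat) (w : seq T) : (size w <= n)%N ->
  #|[set t : k.-tuple (n.-bseq T) | all nonemptyb t && (concat t == w)]|%:R
  = fps_coef (u ^+ k) (size w) :> A.
Proof.
elim: k w => [|k IHk] w le_wn.
  rewrite expr0 coef_fps1 size_eq0; congr (_ %:R).
  case: eqVneq => [-> | w_neq0].
    rewrite (_ : [set t | _] = setT) ?cardsT ?card_tuple //.
    by apply/setP=> t; rewrite !inE tuple0.
  rewrite (_ : [set t | _] = set0) ?cards0 //.
  by apply/setP=> t; rewrite !inE tuple0 /= eq_sym (negbTE w_neq0).
rewrite exprS coef_fpsM -sum1dep_card.
(* For a splitting of [w] the first piece has size at most [size w], so [inord]
   never falls back on its default value there. *)
pose cut (t : k.+1.-tuple (n.-bseq T)) : 'I_(size w).+1 :=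
  inord (size (thead t)).
rewrite (partition_big cut predT) //= natr_sum; apply: eq_bigr => i _.
rewrite uE -size_drop -IHk ?size_drop; last exact: leq_trans (leq_subr _ _) le_wn.
rewrite sum1dep_card -natrM; congr (_ %:R).
have le_iw : (i <= size w)%N by rewrite -ltnS.
pose s := insub_bseq n (take i w).
have val_s : bseqval s = take i w.
  by rewrite /s /insub_bseq val_insubd size_takel // (leq_trans le_iw le_wn).
have cutE (s' : n.-bseq T) (t : k.-tuple (n.-bseq T)) :
    (concat [tuple of s' :: t] == w) && (cut [tuple of s' :: t] == i)
    = (s' == s) && (concat t == drop i w).
  rewrite /cut theadE /concat /= -/(concat t).
  apply/andP/andP => [[/eqP def_w] | [/eqP -> /eqP ->]].
    rewrite -val_eqE /= inordK ?ltnS; last first.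
      by rewrite -def_w size_cat leq_addr.
    rewrite -val_eqE /= val_s; move: (nat_of_ord i) => j /eqP <-.
    by rewrite -def_w take_size_cat // drop_size_cat ?eqxx.
  by rewrite val_s cat_take_drop eqxx size_takel // inord_val.
case: posnP => [i0 | i_gt0].
  rewrite mul0n; apply: eq_card0 => t; rewrite !inE.
  case/tupleP: t => s' t; rewrite -andbA cutE /= andbCA andbA.
  by case: eqP => // ->; rewrite /nonemptyb val_s i0 take0.
rewrite mul1n -(card_imset _ (f := fun t : k.-tuple _ => [tuple of s :: t])).
  apply: eq_card => t; rewrite inE; case/tupleP: t => s' t.
  rewrite -andbA cutE /=; apply/idP/imsetP.
    case/and3P=> /andP[_ t_neq0] /eqP-> cat_t; exists t => //.
    by rewrite inE t_neq0.
  case=> t'; rewrite inE => /andP[t_neq0 cat_t].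
  move=> /(congr1 val) [-> /val_inj ->].
  rewrite t_neq0 cat_t eqxx /nonemptyb val_s /= !andbT.
  by rewrite -size_eq0 size_takel // -lt0n.
by move=> t t' /(congr1 val) [/val_inj].
Qed.

Lemma card_arrangement_coef n k :
  #|[set t : k.-tuple (n.-bseq 'I_n) | arrangement t]|%:R
  = n`!%:R * fps_coef (u ^+ k) n :> A.
Proof.
rewrite -sum1dep_card.
(* The default [ord_tuple n] is never reached on arrangements. *)
pose word (t : k.-tuple (n.-bseq 'I_n)) := insubd (ord_tuple n) (concat t).
rewrite (partition_big word (fun w => uniq w)) /=; last first.
  by move=> t /and3P[_ uniq_t size_t]; rewrite /word val_insubd size_t.
have -> : n`! = #|[set w : n.-tuple 'I_n | uniq w]|.
  rewrite -[in LHS](ffactnn n) -{1}(card_ord n) -card_uniq_tuples.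
  by apply: eq_card => w; rewrite !inE all_predT.
rewrite -sum1dep_card !natr_sum big_distrl /=; apply: eq_bigr => w uniq_w.
rewrite mul1r -[n in RHS](size_tuple w) -(@card_splittings _ n) ?size_tuple //.
rewrite sum1dep_card; congr (_ %:R); apply: eq_card => t; rewrite !inE.
rewrite /arrangement -andbA; case: (all _ _) => //=.
apply/idP/eqP => [/andP[/andP[_ size_t] /eqP <-] | def_w].
  by rewrite /word val_insubd size_t.
rewrite def_w uniq_w size_tuple eqxx /= -val_eqE val_insubd def_w.
by rewrite size_tuple eqxx.
Qed.

Lemma coef_expn_lah n k :
  (k`! * lah n k)%:R = n`!%:R * fps_coef (u ^+ k) n :> A.
Proof. by rewrite -card_arrangement_lah card_arrangement_coef. Qed.

End Splittings.

(** * The generating function *)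

Lemma coef_geometric (A : comUnitRingType) m :
  fps_coef (1 / (1 - fpsX A) - 1) m = (0 < m)%:R.
Proof.
suff -> : 1 / (1 - fpsX A) = FPS (fun=> 1).
  rewrite coef_fpsD coef_fpsN coef_fps1.
  by case: m => [|m]; rewrite ?subrr ?subr0.
have geoK : FPS (fun=> 1) * (1 - fpsX A) = 1.
  apply/fpsP=> -[|n]; rewrite mulrC mulrBl mul1r coef_fpsD coef_fpsN coef_fpsM /=.
    by rewrite big_ord1 mul0r subr0.
  rewrite !big_ord_recl big1 => [|i _]; last exact: mul0r.
  by rewrite mul0r add0r addr0 mulr1 subrr.
have unit_1Bt : 1 - fpsX A \is a GRing.unit.
  by apply/unitrPr; exists (FPS (fun=> 1)); rewrite mulrC.
by rewrite -[X in X / _]geoK mulrK.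
Qed.

(** Both sides have the same coefficient of [(x)_k * y ^ k * t ^ n]: by
    [coef_expn_lah], [c / k! = L(n, k) / n!] for [c] the coefficient of [t ^ n] in
    [(1 / (1 - t) - 1) ^+ k]. Only the invertibility of the factorials matters, so
    [x] and [y] are arbitrary elements rather than indeterminates. *)
Lemma lah_bell_egf (A : comUnitRingType) (x y : A) :
    (forall n, n`!%:R \is a @GRing.unit A) ->
  fps_powr (1 + fpsC y * (1 / (1 - fpsX A) - 1)) x
  = FPS (fun n => lah_bell n x y / n`!%:R).
Proof.
move=> Ufact; apply/fpsP=> n /=; rewrite /lah_bell mulr_suml.
apply: eq_bigr => k _; rewrite addrAC subrr add0r exprMn.
have -> : fpsC y ^+ k = fpsC (y ^+ k).
  elim: (k : nat) => //= j IHj; rewrite exprS IHj.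
  by apply/fpsP=> m; rewrite coef_fpsCM exprS; case: m => //= m; rewrite mulr0.
rewrite coef_fpsCM /binr.
have := coef_expn_lah (@coef_geometric A) n k; set c := fps_coef _ n => lahE.
have {}lahE : (lah n k)%:R / n`!%:R = c / k`!%:R.
  apply: (mulrI (Ufact n)); rewrite mulrCA mulrV // mulr1 mulrA -lahE.
  by rewrite natrM mulrAC mulrV ?mul1r.
by rewrite -[_%:R * _ * _]mulrA [RHS]mulrAC lahE mulrACA mulrC [_ / _]mulrC.
Qed.

Theorem lemma11 (F : fieldType) (charF0 : [pchar F] =i pred0) :
  let x : {mpoly F[2]} := 'X_ord0 in
  let y : {mpoly F[2]} := 'X_ord_max in
  let t : fps {mpoly F[2]} := fpsX _ in
  fps_powr (1 + fpsC y * (1 / (1 - t) - 1)) x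
  = FPS (fun n => lah_bell n x y / n`!%:R).
Proof.
move=> x y t; apply: lah_bell_egf => n.
rewrite -mpolyC_nat; apply: rmorph_unit.
by rewrite unitfE ((pcharf0P F).1 charF0) -lt0n fact_gt0.
Qed.
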